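(* Let $G$ be a connected chordal graph with at least one minimal vertex separator of cardinality $2$. If $\lambda_2(G) < -1/2$, then the diameter of $G$ is at most $3$.
   Context: All graphs are finite, simple and connected. A graph is chordal if every cycle of length at least four has a chord. $d_G(u,v)$ is the length of a shortest path between $u$ and $v$, and the diameter of $G$ is the maximum of $d_G(u,v)$. The distance matrix of $G$ with vertices $v_1,\dots,v_n$ is $\mathbf{D}(G)=[d_G(v_i,v_j)]$; its (real) eigenvalues, counted with multiplicity, are ordered $\lambda_1(G)\ge\lambda_2(G)\ge\cdots\ge\lambda_n(G)$. For non-adjacent vertices $u,v$, a set $S$ of vertices is a $uv$-separator if removing $S$ puts $u$ and $v$ in distinct connected components; it is a minimal $uv$-separator if no proper subset of $S$ is a $uv$-separator. A minimal vertex separator is a set that is a minimal $uv$-separator for some pair of non-adjacent vertices $u,v$. *)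

(* Defs.v *)
From mathcomp Require Import all_boot all_order all_algebra.
From mathcomp Require Import polyrcf.

Set Implicit Arguments.
Unset Strict Implicit.
Unset Printing Implicit Defensive.

Import Order.TTheory GRing.Theory Num.Theory.

Local Open Scope ring_scope.

Section Graphs.

Variables (T : finType) (e : rel T).

Definition simple_graph : Prop := symmetric e /\ irreflexive e.

Definition connected_graph : Prop := forall x y : T, connect e x y.

(* A cycle is a duplicate-free cyclic sequence of vertices; two adjacent
   vertices of it form a chord when neither follows the other on it. *)
Definition chordal : Prop :=
  forall c : seq T, ucycle e c -> (4 <= size c)%N ->
  exists x y : T,
    [/\ x \in c, y \in c, e x y, y != next c x & x != next c y].

Definition walk_of_length (x y : T) (d : nat) : bool :=
  [exists p : d.-tuple T, path e x p && (last x p == y)].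

(* The least length of a walk from x to y, hence of a path.  Such a length is
   less than #|T|; the value is #|T| when y is not reachable from x. *)
Definition dist (x y : T) : nat := find (walk_of_length x y) (iota 0 #|T|).

Definition diameter : nat := (\max_(p : T * T) dist p.1 p.2)%N.

Definition del_rel (S : {set T}) : rel T :=
  [rel x y | [&& x \notin S, y \notin S & e x y]].

Definition separator (u v : T) (S : {set T}) : bool :=
  [&& u \notin S, v \notin S & ~~ connect (del_rel S) u v].

Definition minimal_separator (u v : T) (S : {set T}) : bool :=
  minset (separator u v) S.

Definition minimal_vertex_separator (S : {set T}) : Prop :=
  exists u v : T, [/\ u != v, ~~ e u v & minimal_separator u v S].

Definition distance_matrix (R : pzSemiRingType) : 'M[R]_#|T| :=
  \matrix_(i, j) (dist (enum_val i) (enum_val j))%:R.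

End Graphs.

(* The eigenvalues of M in R, each repeated according to its multiplicity as a
   root of the characteristic polynomial, in nonincreasing order.  When M is
   symmetric there are n of them. *)
Definition eigenvalues (R : rcfType) (n : nat) (M : 'M[R]_n) : seq R :=
  let p := char_poly M in
  sort >=%R (flatten [seq nseq (mup x p) x | x <- rootsR p]).

(* The k-th largest distance eigenvalue, for 1 <= k <= #|T|. *)
Definition dist_eigenvalue (R : rcfType) (T : finType) (e : rel T) (k : nat) : R :=
  (eigenvalues (distance_matrix e R))`_k.-1.

(* Main.v *)
Require Import Defs.
From mathcomp Require Import all_boot all_order all_algebra.
From mathcomp Require Import polyrcf complex lra zify.

Set Implicit Arguments.
Unset Strict Implicit.
Unset Printing Implicit Defensive.

Import Order.TTheory GRing.Theory Num.Theory.

(** In a chordal graph a minimal separator {a, b} is an edge, and each side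
  contains a vertex (u, resp. v) adjacent to both a and b. On this diamond the
  vector w = e_u + e_v - e_a - e_b is isotropic for the form D + I/2, which has
  at most one nonnegative direction when lambda_2 < -1/2. Hence the form is
  nonpositive on every vector orthogonal to w; for e_z, where it is 1/2, this
  says that d(z,u) + d(z,v) <> d(z,a) + d(z,b) for every z off the diamond.
  If the diameter exceeds 3, some z is at distance 2 from {a, b}, and we may
  take z separated from v, with a common neighbour x of z and a. If also
  d(z,b) = 2, chordality provides a common neighbour t of z, a and b, and z
  contradicts the above on the diamond t, v, a, b. Otherwise d(z,b) = 3, and
  either x or z contradicts it on u, v, a, b, or all distances are forced and
  e_z - 2 e_x + 2 e_a is a positive vector orthogonal to w. *)

(** * Distances *)

Section Distance.
Variables (T : finType) (e : rel T).
Hypotheses (e_sym : symmetric e) (e_conn : connected_graph e).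

Lemma walkP x y d :
  reflect (exists p, [/\ size p = d, path e x p & last x p = y])
    (walk_of_length e x y d).
Proof.
apply: (iffP existsP) => [[p /andP[ep /eqP lp]]|[p [sp ep lp]]].
  by exists p; rewrite size_tuple.
by move/eqP: sp => sp; exists (Tuple sp); rewrite /= ep lp eqxx.
Qed.

Lemma dist_le x y p : path e x p -> last x p = y -> dist e x y <= size p.
Proof.
move=> ep lp; rewrite /dist; case: (ltnP (size p) #|T|) => [lt|le]; last first.
  (* [dist] is at most [#|T|], the value of [find] on failure. *)
  by apply: leq_trans le; rewrite -{2}(size_iota 0 #|T|) find_size.
rewrite leqNgt; apply/negP => /(before_find 0%N).
by rewrite nth_iota // add0n => /walkP[]; exists p.
Qed.

(** A duplicate-free path has fewer than [#|T|] edges, so the bounded search in [dist] succeeds and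
    returns the length of an actual walk. *)
Lemma dist_path x y :
  exists p, [/\ path e x p, last x p = y & size p = dist e x y].
Proof.
have /connectP[p0 ep0 ->] := e_conn x y.
case/shortenP: ep0 => p ep up _.
have has_walk : has (walk_of_length e x (last x p)) (iota 0 #|T|).
  apply/hasP; exists (size p); last by apply/walkP; exists p.
  by rewrite mem_iota add0n /=; move/card_uniqP: up => /= <-; apply: max_card.
have := nth_find 0%N has_walk.
have lt : find (walk_of_length e x (last x p)) (iota 0 #|T|) < #|T|.
  by rewrite -[X in _ < X](size_iota 0) -has_find.
rewrite nth_iota // add0n.
by case/walkP => q [sq eq lq]; exists q.
Qed.

Lemma dist_self x : dist e x x = 0.
Proof. by apply/eqP; rewrite -leqn0 (@dist_le x x [::]). Qed.

Lemma dist_eq0 x y : (dist e x y == 0) = (x == y).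
Proof.
apply/eqP/eqP => [d0|->]; last exact: dist_self.
by have [p [_ lp]] := dist_path x y; rewrite d0 -lp => /size0nil->.
Qed.

Lemma dist_triangle y x z : dist e x z <= dist e x y + dist e y z.
Proof.
have [p [ep lp <-]] := dist_path x y; have [q [eq lq <-]] := dist_path y z.
rewrite -size_cat; apply: dist_le; first by rewrite cat_path ep lp.
by rewrite last_cat lp.
Qed.

Lemma dist_sym x y : dist e x y = dist e y x.
Proof.
suff le u v : dist e u v <= dist e v u by apply/eqP; rewrite eqn_leq !le.
have [p [ep lp <-]] := dist_path v u.
rewrite -(size_belast v) -size_rev; apply: dist_le.
  by rewrite -lp rev_path; under eq_path do rewrite e_sym.
by case: p lp {ep} => [|z p] //=; rewrite rev_cons last_rcons.
Qed.

Lemma dist_edge_le x y : e x y -> dist e x y <= 1.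
Proof. by move=> exy; apply: (@dist_le x y [:: y]); rewrite //= exy. Qed.

Lemma dist_le1 x y : (dist e x y <= 1) = (x == y) || e x y.
Proof.
apply/idP/idP => [|/predU1P[->|]]; [|by rewrite dist_self | exact: dist_edge_le].
have [p [ep <- <-]] := dist_path x y.
case: p ep => [|z [|w p]] //=; first by rewrite eqxx.
by rewrite andbT => ->; rewrite orbT.
Qed.

(** A shortest path must meet [S], and is cut at such a vertex. *)
Lemma separated_dist (S : {set T}) x y : x \notin S -> ~~ connect (del_rel e S) x y ->
  exists2 s, s \in S & dist e x s + dist e s y <= dist e x y.
Proof.
move=> xS nxy; have [p [ep lp <-]] := dist_path x y.
have /hasP[s sp sS] : has (mem S) p.
  apply: contraR nxy; rewrite -all_predC => pS.
  apply/connectP; exists p => //; elim: p x xS ep pS {lp} => //= z p IH x xS.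
  by case/andP=> exz ep /andP[zS pS]; rewrite /del_rel /= xS zS exz IH.
exists s => //; case/splitPr: sp ep lp => p1 p2.
rewrite -cat_rcons cat_path last_cat last_rcons size_cat => /andP[ep1 ep2] lp.
by rewrite leq_add // dist_le // last_rcons.
Qed.

End Distance.

(** * Chordal graphs and minimal separators *)

Lemma next_cat_cons (T : eqType) (s1 s2 : seq T) x y :
  uniq (s1 ++ x :: y :: s2) -> next (s1 ++ x :: y :: s2) x = y.
Proof.
move=> us; rewrite -(next_rot (size s1)) // rot_size_cat /= eqxx //.
Qed.

Lemma next_last (T : eqType) (s : seq T) x y :
  uniq (x :: rcons s y) -> next (x :: rcons s y) y = x.
Proof.
move=> us; rewrite -(next_rotr 1) // -rcons_cons rotr1_rcons /= eqxx //.
Qed.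

Section Chordal.
Variables (T : finType) (e : rel T).
Hypotheses (e_sym : symmetric e) (e_irr : irreflexive e) (e_chordal : chordal e).

(** The list [q] is the rest of a cycle through the path, and [next] refers to the whole cycle. A
    chord from [x] to a later [y] on the path replaces the stretch between them; excluding the pair
    [a], [b] keeps an inner vertex. *)
Lemma path_shortcut_ordered a b p q s1 x s2 y s3 :
    a :: rcons p b = s1 ++ x :: s2 ++ y :: s3 ->
    path e a (rcons p b) -> uniq (a :: rcons p b ++ q) -> e x y ->
    y != next (a :: rcons p b ++ q) x -> ~~ ((x == a) && (y == b)) ->
  exists p', [/\ path e a (rcons p' b), subseq p' p, 0 < size p' & size p' < size p].
Proof.
move=> sE ep up exy; rewrite -cat_cons sE in up *.
case: s2 => [|w s2] in sE up *.
  by rewrite -catA /= in up *; rewrite next_cat_cons ?eqxx.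
(* The four cases record whether [x] is [a] and whether [y] is [b]. *)
move=> _; case: s1 => [|a' s1] in sE up *; case/lastP: s3 => [|s3 b'] in sE up *.
- case: sE => <- /eqP; rewrite -cat_cons cats1 eqseq_rcons => /andP[_ /eqP <-].
  by rewrite !eqxx.
- case: sE => ax /eqP.
  rewrite -rcons_cons -rcons_cat -rcons_cons eqseq_rcons => /andP[/eqP pE /eqP bE] _.
  subst; exists (y :: s3); split=> //.
  + by move: ep; rewrite !rcons_cons /= rcons_cat cat_path /= exy => /and4P[].
  + by rewrite -cat_cons suffix_subseq.
  + by rewrite /= size_cat /= ltnS addnS ltnS leq_addl.
- case: sE => aE /eqP; rewrite -!cat_cons catA cats1 eqseq_rcons => /andP[/eqP pE /eqP bE] _.
  subst; exists (rcons s1 x); split.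
  + move: ep; rewrite !rcons_cat cat_path !rcons_path /= => /andP[-> /andP[/andP[-> _] _]] /=.
    by rewrite last_rcons exy.
  + by rewrite -cat_rcons prefix_subseq.
  + by rewrite size_rcons.
  + by rewrite size_rcons size_cat /= !addnS ltnS leq_addr.
case: sE => aE /eqP.
rewrite -!rcons_cons -!rcons_cat -!rcons_cons -rcons_cat eqseq_rcons => /andP[/eqP pE /eqP bE] _.
subst; exists (s1 ++ x :: y :: s3); split.
- move: ep; rewrite !rcons_cat !cat_path /= rcons_cat cat_path /= exy.
  by case/and5P=> -> -> _ _ /andP[].
- apply: cat_subseq => //; rewrite -[x :: y :: s3]cat1s -[x :: _ :: _]cat1s.
  by rewrite cat_subseq // -cat_cons suffix_subseq.
- by rewrite size_cat addnS.
- by rewrite !size_cat /= size_cat /= !addnS !ltnS leq_add2l leq_addl.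
Qed.

Lemma path_shortcut a b p q x y :
    path e a (rcons p b) -> uniq (a :: rcons p b ++ q) ->
    x \in a :: rcons p b -> y \in a :: rcons p b -> e x y ->
    y != next (a :: rcons p b ++ q) x -> x != next (a :: rcons p b ++ q) y ->
    ~~ ((x == a) && (y == b)) -> ~~ ((x == b) && (y == a)) ->
  exists p', [/\ path e a (rcons p' b), subseq p' p, 0 < size p' & size p' < size p].
Proof.
move=> ep up; have ordered x' y' s1 s2 s3 := @path_shortcut_ordered a b p q s1 x' s2 y' s3.
case/splitPr sE: _ / => [s1 s2].
rewrite mem_cat inE => /or3P[ys1|/eqP->|ys2] exy nyx nxy nab nba; last 1 first.
- case/splitPr: ys2 sE => s3 s4 sE.
  by apply: (ordered x y s1 s3 s4).
- case/splitPr: ys1 sE => s3 s4; rewrite -catA => sE.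
  by apply: (ordered y x s3 s4 s2) => //; rewrite 1?e_sym // andbC.
by rewrite e_irr in exy.
Qed.

(** The edge [a b] closes the path to a cycle, of which it is not a chord. While two inner vertices
    remain, a chord shortens the path; a single inner vertex is the apex. *)
Lemma triangle_on_edge a b p :
    e a b -> path e a (rcons p b) -> uniq (a :: rcons p b) -> 0 < size p ->
  exists2 z, z \in p & e a z && e z b.
Proof.
move=> eab; have [n] := ubnP (size p); elim: n p => // n IH p; rewrite ltnS => pn ep up p0.
case: (ltnP 1 (size p)) => [p1|]; last first.
  case: p p0 ep {up pn} => [//|z [|//]] _ /and3P[eaz ezb _] _.
  by exists z; rewrite ?inE // eaz.
have cyc : ucycle e (a :: rcons p b).
  by rewrite /ucycle up andbT /= rcons_path ep last_rcons e_sym.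
have [|x [y [xc yc exy nyx nxy]]] := e_chordal cyc.
  by rewrite /= size_rcons.
have nba : next (a :: rcons p b) b = a by apply: next_last.
have [|||||p' [ep' sub p'0 lt]] := @path_shortcut a b p [::] x y ep _ xc yc exy;
  rewrite ?cats0 //.
- by apply: contra nxy => /andP[/eqP-> /eqP->]; rewrite nba.
- by apply: contra nyx => /andP[/eqP-> /eqP->]; rewrite nba.
have [||||z zp' ezab] := IH p' => //.
- exact: leq_trans pn.
- by apply: subseq_uniq up; rewrite /= eqxx -!cats1 cat_subseq.
by exists z; rewrite ?(mem_subseq sub).
Qed.

(** The two paths form a cycle. A chord other than [a b] with both ends on one closed path shortens
    that path, and induction on the total length applies; chords between the interiors are
    excluded. *)
Lemma theta_chord a b p q :
    path e a (rcons p b) -> path e b (rcons q a) -> uniq (a :: rcons p b ++ q) ->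
    0 < size p -> 0 < size q -> {in p & q, forall x y, ~~ e x y} ->
  e a b.
Proof.
have [n] := ubnP (size p + size q); elim: n a b p q => // n IH a b p q.
rewrite ltnS => pqn ep eq upq p0 q0 npq.
set c := a :: rcons p b ++ q in upq.
have cyc : ucycle e c.
  by rewrite /ucycle upq andbT /= rcons_cat cat_path ep last_rcons.
have [|x [y [xc yc exy nyx nxy]]] := e_chordal cyc.
  by rewrite /c /= size_cat size_rcons addSn !ltnS -[2]/(1 + 1) leq_add.
have [/andP[/eqP <- /eqP <-] //|nab] := boolP ((x == a) && (y == b)).
have [/andP[/eqP <- /eqP <-]|nba] := boolP ((x == b) && (y == a)).
  by rewrite e_sym.
(* The same cycle read from [b], so that [path_shortcut] applies to the second path. *)
have c2E : b :: rcons q a ++ p = rot (size (a :: p)) c.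
  by rewrite /c !cat_rcons -cat_cons rot_size_cat.
have upq2 : uniq (b :: rcons q a ++ p) by rewrite c2E rot_uniq.
have next2 : next (b :: rcons q a ++ p) =1 next c by move=> z; rewrite c2E next_rot.
have sub_uniq p' q' : subseq p' p -> subseq q' q -> uniq (a :: rcons p' b ++ q').
  move=> sp sq; apply: subseq_uniq upq; rewrite /c /= eqxx.
  by rewrite cat_subseq // -!cats1 cat_subseq.
have [/andP[x1 y1]|n1] := boolP ((x \in a :: rcons p b) && (y \in a :: rcons p b)).
  have [p' [ep' sub p'0 lt]] := path_shortcut ep upq x1 y1 exy nyx nxy nab nba.
  apply: (IH _ _ p' q) => //;
    [by apply: leq_trans pqn; rewrite ltn_add2r | exact: sub_uniq |].
  by move=> z w /(mem_subseq sub); apply: npq.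
have [/andP[x2 y2]|n2] := boolP ((x \in b :: rcons q a) && (y \in b :: rcons q a)).
  have [||q' [eq' sub q'0 lt]] := path_shortcut eq upq2 x2 y2 exy _ _ nba nab.
  - by rewrite next2.
  - by rewrite next2.
  apply: (IH _ _ p q') => //;
    [by apply: leq_trans pqn; rewrite ltn_add2l | exact: sub_uniq |].
  by move=> z w zp /(mem_subseq sub); apply: npq.
(* A chord contained in neither closed path would join the two interiors. *)
have n3 : ~~ ((x \in p) && (y \in q)).
  by apply/negP => /andP[xp yq]; rewrite (negPf (npq _ _ xp yq)) in exy.
have n4 : ~~ ((y \in p) && (x \in q)).
  by apply/negP => /andP[yp xq]; rewrite e_sym (negPf (npq _ _ yp xq)) in exy.
move: xc yc n1 n2 n3 n4; rewrite /c !inE !mem_cat !mem_rcons !inE.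
by do 4 case: (_ == _); do 4 case: (_ \in _).
Qed.

(** * Components of the complement of a minimal separator *)

Lemma connect_preserves (r : rel T) (P : pred T) x y :
  (forall z w, P z -> r z w -> P w) -> P x -> connect r x y -> P y.
Proof.
move=> step Px /connectP[p rp ->]; elim: p x Px rp => //= z p IH x Px /andP[xz].
exact: IH (step _ _ Px xz).
Qed.

Implicit Type S : {set T}.

Lemma connect_del_sym S : connect_sym (del_rel e S).
Proof.
by apply: sym_connect_sym => x y; rewrite /del_rel /= e_sym andbCA.
Qed.

Lemma connect_del_notin S x y : x \notin S -> connect (del_rel e S) x y -> y \notin S.
Proof. by apply: (@connect_preserves _ (fun z => z \notin S)) => z w _ /and3P[]. Qed.

Lemma separatorC u v S : separator e u v S = separator e v u S.
Proof. by rewrite /separator connect_del_sym andbCA. Qed.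

Lemma minimal_separatorC u v S : minimal_separator e u v S -> minimal_separator e v u S.
Proof.
case/minsetP=> sepS minS; apply/minsetP; split; first by rewrite separatorC.
by move=> B; rewrite separatorC => /minS.
Qed.

(** By minimality a path from [u] to [v] avoids [S :\ s]. If no vertex of the component of [u] were
    adjacent to [s], this path could never leave that component, although [v] lies outside it. *)
Lemma minimal_separator_neighbor u v S s : minimal_separator e u v S -> s \in S ->
  exists2 x, connect (del_rel e S) u x & e x s.
Proof.
case/minsetP=> /and3P[uS vS nuv] minS sS.
have : connect (del_rel e (S :\ s)) u v.
  apply: contraLR sS => nuv'; rewrite -(minS (S :\ s)) ?subsetDl ?setD11 //.
  by rewrite /separator !inE (negPf uS) (negPf vS) !andbF.
move=> uv; have [/existsP[x /andP[]]|none] :=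
    boolP [exists x, connect (del_rel e S) u x && e x s]; first by exists x.
case/negP: nuv; apply: connect_preserves uv => // z w uz /and3P[zS wS zw].
have zS' := connect_del_notin uS uz.
apply: (connect_trans uz); apply: connect1; rewrite /del_rel /= zS' zw andbT.
apply: contraNN wS => wS; rewrite !inE wS andbT; apply: contraNneq none => ws.
by apply/existsP; exists z; rewrite uz -ws.
Qed.

(** Paths obtained in this way through two different components form a cycle without edges between
    their interiors. *)
Lemma path_through_component u S a b x y : u \notin S -> a \in S -> b \in S -> a != b ->
    connect (del_rel e S) u x -> connect (del_rel e S) u y -> e a x -> e y b ->
  exists p, [/\ path e a (rcons p b), uniq (a :: rcons p b), 0 < size p &
    {in p, forall z, connect (del_rel e S) u z}].
Proof.
move=> uS aS bS ab ux uy ax yb.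
have : connect (del_rel e S) x y by apply: connect_trans uy; rewrite connect_del_sym.
case/connectP=> p0 /shortenP[p dp up _] yE; exists (x :: p).
have inC : {in x :: p, forall z, connect (del_rel e S) u z}.
  by move=> z zp; apply: connect_trans ux (path_connect dp zp).
have notC z : z \in S -> z \notin x :: p.
  by move=> zS; apply/negP => /inC /(connect_del_notin uS); rewrite zS.
split=> //.
  rewrite /= ax rcons_path -yE yb andbT.
  by apply: sub_path dp => z w /and3P[].
by rewrite cons_uniq mem_rcons rcons_uniq up inE negb_or ab !notC.
Qed.

(** Paths through the components of [u] and [v] make [a b] an edge by [theta_chord];
    [triangle_on_edge] then finds an apex in each component. The vertices [u] and [v] themselves may
    be far from [S]. *)
Lemma separator_diamond u v S : minimal_separator e u v S -> #|S| = 2 ->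
  exists a b u' v', [/\ S = [set a; b], e a b,
    [/\ u' \notin S, e a u' & e u' b], [/\ v' \notin S, e a v' & e v' b] &
    ~~ connect (del_rel e S) u' v'].
Proof.
move=> minS /eqP/cards2P[a [b [ab SE]]].
have := minS; case/minsetP=> /and3P[uS vS nuv] _.
have aS : a \in S by rewrite SE !inE eqxx.
have bS : b \in S by rewrite SE !inE eqxx orbT.
have minS' := minimal_separatorC minS.
have [x1 ux1 x1a] := minimal_separator_neighbor minS aS.
have [x2 ux2 x2b] := minimal_separator_neighbor minS bS.
have [y1 vy1 y1a] := minimal_separator_neighbor minS' aS.
have [y2 vy2 y2b] := minimal_separator_neighbor minS' bS.
rewrite e_sym in x1a; have [p [ep up p0 pC]] := path_through_component uS aS bS ab ux1 ux2 x1a x2b.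
rewrite e_sym in y2b; rewrite eq_sym in ab.
have [q [eq uq q0 qC]] := path_through_component vS bS aS ab vy2 vy1 y2b y1a.
have sep x y : connect (del_rel e S) u x -> connect (del_rel e S) v y ->
    ~~ connect (del_rel e S) x y.
  move=> ux vy; apply: contra nuv => xy.
  by rewrite (connect_trans ux) // (connect_trans xy) // connect_del_sym.
have npq : {in p & q, forall x y, ~~ e x y}.
  move=> x y /pC ux /qC vy; apply: contra (sep _ _ ux vy) => xy.
  by rewrite connect1 // /del_rel /= xy (connect_del_notin uS ux) (connect_del_notin vS vy).
have upq : uniq (a :: rcons p b ++ q).
  rewrite cat_rcons -cat_cons cat_uniq.
  have -> : uniq (a :: p).
    by move: up; rewrite -rcons_cons rcons_uniq => /andP[].
  move: uq; rewrite -rcons_cons rcons_uniq => /andP[aq ->]; rewrite andbT.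
  apply/hasPn => z /=; rewrite !inE => /predU1P[->|zq].
    move: up; rewrite -rcons_cons rcons_uniq => /andP[] //.
  rewrite negb_or; apply/andP; split.
    by apply: contraNneq aq => <-; rewrite inE zq orbT.
  by apply/negP => /pC uz; have := sep _ _ uz (qC _ zq); rewrite connect0.
have eab := theta_chord ep eq upq p0 q0 npq.
have [u' u'p /andP[au' u'b]] := triangle_on_edge eab ep up p0.
rewrite e_sym in eab; have [v' v'q /andP[bv' v'a]] := triangle_on_edge eab eq uq q0.
exists a, b, u', v'; split=> //; last by rewrite sep ?pC ?qC.
- by rewrite e_sym.
- by rewrite au' u'b (connect_del_notin uS) ?pC.
- by rewrite e_sym v'a e_sym bv' (connect_del_notin vS) ?qC.
Qed.
End Chordal.

Local Open Scope ring_scope.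

(** * Symmetric matrices over a real closed field *)

(** The multiplicity of a root is the number of its occurrences in [s], so the two unsorted lists
    are permutations of each other. *)
Lemma eigenvalues_prod (R : rcfType) n (M : 'M[R]_n) (s : seq R) :
  char_poly M = \prod_(x <- s) ('X - x%:P) -> eigenvalues M = sort >=%R s.
Proof.
move=> charM; rewrite /eigenvalues charM.
apply/perm_sortP => //; [exact: ge_total | exact: ge_trans | exact: ge_anti |].
set p := \prod_(x <- s) _.
have p0 : p != 0 by rewrite monic_neq0 // monic_prod_XsubC.
have memr x : (x \in rootsR p) = (x \in s).
  have := roots_on_rootsR p0 x.
  by rewrite in_itv /= root_prod_XsubC => <-.
have uniqr : uniq (rootsR p) by apply: uniq_roots.
apply/allP => x _ /=; apply/eqP.
rewrite count_flatten -map_comp sumnE big_map.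
have countE y : (count_mem x \o (fun z => nseq (mup z p) z)) y =
    if y == x then count_mem x s else 0%N.
  rewrite /= count_nseq mu_prod_XsubC /=.
  by case: eqP => [->|_]; rewrite ?mul1n ?mul0n.
rewrite (eq_bigr _ (fun y _ => countE y)).
have [xr|xNr] := boolP (x \in rootsR p).
  by rewrite (bigD1_seq x) //= eqxx big1 ?addn0 // => y /negPf ->.
rewrite big1_seq => [|y /andP[_ yr]]; last first.
  by case: eqP => // yx; rewrite -yx yr in xNr.
by apply/esym/count_memPn; rewrite -memr.
Qed.

(** Index 1 is the second largest entry. On a list of fewer than two entries it is the default 0,
    and the bound is trivial. *)
Lemma count_ge_sort (R : rcfType) (c : R) (s : seq R) :
  (sort >=%R s)`_1 < c -> (count (>= c) s <= 1)%N.
Proof.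
rewrite -(permP (permEl (perm_sort >=%R s))).
have := sort_sorted (@ge_total _ R) s.
case: (sort _ s) => [|x [|y t]] //=; first by rewrite addn0 leq_b1.
move=> /andP[_ yt] yc; rewrite (lt_geF yc) add0n.
rewrite (_ : count _ t = 0%N) ?addn0 ?leq_b1 //.
apply/eqP; rewrite -leqn0 leqNgt -has_count -all_predC.
have := order_path_min ge_trans yt.
by apply: sub_all => z /= zy; rewrite -ltNge (le_lt_trans zy yc).
Qed.

Lemma char_poly_similar (F : comNzRingType) n (P Q A : 'M[F]_n) :
  Q *m P = 1%:M -> char_poly (Q *m A *m P) = char_poly A.
Proof.
move=> QP1; rewrite /char_poly.
have <- : map_mx polyC Q *m char_poly_mx A *m map_mx polyC P
    = char_poly_mx (Q *m A *m P).
  rewrite /char_poly_mx mulmxBr mulmxBl !map_mxM; congr (_ - _).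
  by rewrite mul_mx_scalar -scalemxAl -map_mxM QP1 map_mx1 scalemx1.
rewrite !det_mulmx mulrAC -det_mulmx -map_mxM QP1 map_mx1 det1.
by rewrite mul1r.
Qed.

Section Spectral.
Local Open Scope sesquilinear_scope.
Variables (R : rcfType) (n : nat).
Local Notation C := R[i].
Implicit Types (M : 'M[R]_n) (x y : 'rV[R]_n).

Local Notation rc := (map_mx (real_complex R)).

Definition bil M x y : R := (x *m M *m y^T) 0 0.

(** The matrix is Hermitian over [R[i]], where the spectral theorem applies; the diagonal being
    real, the characteristic polynomial already splits over [R]. *)
Lemma symmetric_spectral M : M^T = M ->
  exists (P : 'M[C]_n) (d : 'I_n -> R),
   [/\ P \is unitarymx, eigenvalues M = sort >=%R [seq d i | i : 'I_n] &
     map_mx (real_complex R) M = P^t* *m diag_mx (\row_i (d i)%:C%C) *m P].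
Proof.
move=> Msym; set A := map_mx (real_complex R) M.
have Areal : A \is a realmx.
  by apply/mxOverP => i j; rewrite mxE complex_real.
have Asym : A \is symmetricmx.
  by apply/is_hermitianmxP; rewrite expr0 scale1r map_mx_id // /A map_trmx Msym.
have Aherm := realsym_hermsym Asym Areal.
have := hermitian_spectral_diag_real Aherm.
have /orthomx_spectralP := hermitian_normalmx Aherm.
have Punit := spectral_unitarymx A.
move: (spectralmx A) (spectral_diag A) Punit => P D Punit.
rewrite invmx_unitary // => AE Dreal.
pose d i := complex.Re (D 0 i).
have DE : D = \row_i (d i)%:C%C.
  by apply/rowP => i; rewrite mxE /d RRe_real // (mxOverP Dreal).
exists P, d; split=> //; last by rewrite -DE.
apply: eigenvalues_prod; apply: (map_poly_inj (real_complex R)).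
rewrite map_char_poly -/A AE char_poly_similar; last first.
  by rewrite -invmx_unitary // mulVmx // unitarymx_unit.
rewrite char_poly_trig ?diag_mx_is_trig // rmorph_prod /= big_image_cond /=.
apply: eq_bigr => i _; rewrite rmorphB /= map_polyX map_polyC /=.
by rewrite !mxE eqxx mulr1n DE mxE.
Qed.

Lemma bil_sym M x y : M^T = M -> bil M y x = bil M x y.
Proof.
move=> Msym; rewrite /bil.
by rewrite -[y *m M *m _]trmxK [LHS]mxE !trmx_mul trmxK Msym mulmxA.
Qed.

Lemma conj_real_row x : (rc x)^t* = (rc x)^T.
Proof. by apply/matrixP => i j; rewrite !mxE; apply: conjc_real. Qed.

Lemma bil_complex M x y :
  (rc x *m rc M *m (rc y)^t*) 0 0
    = (bil M x y)%:C%C.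
Proof. by rewrite conj_real_row map_trmx -!map_mxM mxE. Qed.

(** Orthogonality kills the cross terms. The coefficients are complex because coordinates in the
    eigenbasis [P] are. *)
Lemma complex_form M x y (a b : C) (z := a *: rc x + b *: rc y) :
  M^T = M -> bil M x y = 0 ->
  (z *m rc M *m z^t*) 0 0 =
    `|a| ^+ 2 * (bil M x x)%:C%C + `|b| ^+ 2 * (bil M y y)%:C%C.
Proof.
move=> Msym Bxy; rewrite /z linearD !linearZ /= map_mxD !map_mxZ /=.
rewrite !mulmxDl !mulmxDr -!scalemxAl -!scalemxAr.
have := (bil_complex M x x, bil_complex M x y, bil_complex M y x, bil_complex M y y).
rewrite (bil_sym x y Msym) Bxy.
move: (_ *m (rc x)^t*) (_ *m (rc y)^t*) (_ *m (rc x)^t*) (_ *m (rc y)^t*).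
move=> A1 A2 A3 A4 [[[E1 E2] E3] E4]; rewrite !mxE E1 E2 E3 E4 !mulr0 addr0 add0r.
by rewrite !mulrA -!normCK.
Qed.

(** If at most one eigenvalue were at least [c], some combination of [x] and [y], with coefficients
    not both zero, would lie where the form of [M - c%:M] is negative definite, yet that form is
    nonnegative on their span. The vector [x] may be isotropic. *)
Lemma second_eigenvalue_ge M (c : R) x y : M^T = M -> x != 0 ->
  0 <= bil (M - c%:M) x x -> bil (M - c%:M) x y = 0 ->
  0 < bil (M - c%:M) y y -> c <= (eigenvalues M)`_1.
Proof.
move=> Msym x0 Bxx Bxy Byy; rewrite leNgt; apply/negP.
have [P [d [Punit -> ME]]] := symmetric_spectral Msym.
move/count_ge_sort.
rewrite count_map -size_filter enumT => d1.
have {}d1 : (#|[pred i | (c <= d i)%R]| <= 1)%N by rewrite cardE /enum_mem.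
pose X := rc x *m P^t*; pose Y := rc y *m P^t*.
(* At most one eigenvalue is >= c, so some nonzero combination of x and y has
   no component along its eigenvector. *)
have [[a b] ab0 ab] : exists2 ab : C * C, ab != (0, 0) &
    forall i, c <= d i -> ab.1 * X 0 i + ab.2 * Y 0 i = 0.
  case: (pickP (fun i => c <= d i)) => [i0 ci0|none]; last first.
    by exists (1, 0) => [|i]; rewrite ?xpair_eqE ?oner_eq0 // none.
  have unique i : c <= d i -> i = i0.
    by move=> ci; apply: (card_le1_eqP d1).
  have [Xi0|Xi0] := eqVneq (X 0 i0) 0.
    exists (1, 0) => [|i /unique -> /=]; first by rewrite xpair_eqE oner_eq0.
    by rewrite Xi0 mulr0 mul0r addr0.
  exists (Y 0 i0, - X 0 i0) => [|i /unique -> /=].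
    by rewrite xpair_eqE oppr_eq0 (negPf Xi0) andbF.
  by rewrite mulNr mulrC subrr.
set z := a *: rc x + b *: rc y; pose u := z *m P^t*.
have uE i : u 0 i = a * X 0 i + b * Y 0 i.
  by rewrite /u /z mulmxDl -!scalemxAl !mxE.
have formE : (z *m rc (M - c%:M) *m z^t*) 0 0
    = \sum_i (d i - c)%:C%C * `|u 0 i| ^+ 2.
  have -> : rc (M - c%:M) = P^t* *m diag_mx (\row_i (d i - c)%:C%C) *m P.
    have -> : \row_i (d i - c)%:C%C = \row_i (d i)%:C%C - const_mx c%:C%C :> 'rV[C]_n.
      by apply/rowP => i; rewrite !mxE rmorphB.
    rewrite linearB /= mulmxBr mulmxBl -ME diag_const_mx map_mxB map_scalar_mx.
    rewrite mul_mx_scalar -scalemxAl -[P^t*]invmx_unitary // mulVmx ?unitarymx_unit //.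
    by rewrite scalemx1.
  have -> : z *m (P^t* *m diag_mx (\row_i (d i - c)%:C%C) *m P) *m z^t*
      = u *m diag_mx (\row_i (d i - c)%:C%C) *m u^t*.
    by rewrite /u trmx_mul map_mxM /= trmxCK !mulmxA.
  rewrite mul_mx_diag mxE; apply: eq_bigr => i _.
  by rewrite !mxE mulrAC [LHS]mulrC normCK.
have term_le0 i : true -> (d i - c)%:C%C * `|u 0 i| ^+ 2 <= 0.
  move=> _; have [ci|dc] := leP c (d i); first by rewrite uE ab // normr0 expr0n mulr0.
  by rewrite mulr_le0_ge0 ?exprn_ge0 // lecR subr_le0 ltW.
have NMsym : (M - c%:M)^T = M - c%:M by rewrite linearB /= tr_scalar_mx Msym.
have ge0a : 0 <= `|a| ^+ 2 * (bil (M - c%:M) x x)%:C%C.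
  by rewrite mulr_ge0 ?exprn_ge0 // lecR.
have ge0b : 0 <= `|b| ^+ 2 * (bil (M - c%:M) y y)%:C%C.
  by rewrite mulr_ge0 ?exprn_ge0 // lecR ltW.
(* Nonpositive in the eigenbasis, nonnegative on the span of [x] and [y]. *)
have form0 : (z *m rc (M - c%:M) *m z^t*) 0 0 = 0.
  apply/eqP; rewrite eq_le {1}formE sumr_le0 //=.
  by rewrite complex_form // addr_ge0.
have b0 : b = 0.
  have /eqP := form0; rewrite complex_form // paddr_eq0 //.
  by case/andP=> _; rewrite mulf_eq0 expf_eq0 normr_eq0
    (fmorph_eq0 (real_complex R)) (gt_eqF Byy) orbF => /eqP.
(* A vanishing sum of nonpositive terms has only zero terms, and [d i - c] is nonzero when
   [d i < c]. *)
have u0 : u = 0.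
  apply/rowP => i; rewrite [RHS]mxE; have [ci|dc] := leP c (d i); first by rewrite uE ab.
  have /eqP := form0; rewrite formE -oppr_eq0 -sumrN psumr_eq0; last first.
    by move=> j _; rewrite oppr_ge0 term_le0.
  move/allP/(_ i (mem_index_enum _)).
  rewrite /= oppr_eq0 mulf_eq0 expf_eq0 normr_eq0 => /orP[|/eqP //].
  by rewrite (fmorph_eq0 (real_complex R)) subr_eq0 (lt_eqF dc).
have /eqP : z = 0.
  rewrite -[z]mulmx1 -(mulVmx (unitarymx_unit Punit)) invmx_unitary //.
  by rewrite mulmxA -/u u0 mul0mx.
rewrite /z b0 scale0r addr0 scaler_eq0 map_mx_eq0 (negPf x0) orbF => a0.
by move: ab0; rewrite b0 xpair_eqE a0 eqxx.
Qed.
End Spectral.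

(** * Bilinearity of the form *)

Section Bil.
Variables (R : rcfType) (n : nat).
Implicit Types (M : 'M[R]_n) (x y z : 'rV[R]_n).

Lemma bilDl M x y z : bil M (x + y) z = bil M x z + bil M y z.
Proof. by rewrite /bil !mulmxDl mxE. Qed.

Lemma bilDr M x y z : bil M x (y + z) = bil M x y + bil M x z.
Proof. by rewrite /bil linearD mulmxDr mxE. Qed.

Lemma bilZl M a x y : bil M (a *: x) y = a * bil M x y.
Proof. by rewrite /bil -!scalemxAl mxE. Qed.

Lemma bilZr M a x y : bil M x (a *: y) = a * bil M x y.
Proof. by rewrite /bil linearZ -scalemxAr mxE. Qed.

Lemma bilNl M x y : bil M (- x) y = - bil M x y.
Proof. by rewrite -scaleN1r bilZl mulN1r. Qed.

Lemma bilNr M x y : bil M x (- y) = - bil M x y.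
Proof. by rewrite -scaleN1r bilZr mulN1r. Qed.

Lemma bil_delta M i j : bil M (delta_mx 0 i) (delta_mx 0 j) = M i j.
Proof. by rewrite /bil trmx_delta -rowE -colE !mxE. Qed.
End Bil.

(** * Diamonds in graphs with second distance eigenvalue below -1/2 *)

Section Forbidden.
Variables (R : rcfType) (T : finType) (e : rel T).
Hypotheses (e_sym : symmetric e) (e_conn : connected_graph e).
Hypothesis lambda2_lt : dist_eigenvalue R e 2 < - (1 / 2%:R).

Let vertex (s : T) : 'rV[R]_#|T| := delta_mx 0 (enum_rank s).
(** The form of D + I/2, that is of [M - c%:M] at the threshold c = -1/2. *)
Let form := bil (distance_matrix e R - (- (1 / 2%:R))%:M).
Local Notation d := (dist e).

(** Equality is tested as distance zero, so that known distances determine every value of the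
    form. *)
Lemma form_vertex s t : form (vertex s) (vertex t) = (d s t)%:R + (d s t == 0%N)%:R / 2%:R.
Proof.
rewrite /form bil_delta !mxE !enum_rankK (inj_eq enum_rank_inj) dist_eq0 //.
by case: (s == t); rewrite /=; lra.
Qed.

(** The complete graph on four vertices without the edge [u v], given by distances because only
    these enter the form. *)
Definition diamond u v a b :=
  [/\ d u v = 2, d u a = 1 & d u b = 1]%N /\ [/\ d v a = 1, d v b = 1 & d a b = 1]%N.

(** The vector w = e_u + e_v - e_a - e_b is nonzero and isotropic, so it can serve as [x] in
    [second_eigenvalue_ge], which then excludes a positive [y]. *)
Lemma diamond_orthogonal u v a b (y : 'rV[R]_#|T|) :
    diamond u v a b ->
    form (vertex u + vertex v - vertex a - vertex b) y = 0 -> form y y <= 0.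
Proof.
move=> [[duv dua dub] [dva dvb dab]] wy; rewrite leNgt; apply/negP => yy.
move: lambda2_lt; rewrite /dist_eigenvalue /= ltNge => /negP; apply.
have Dsym : (distance_matrix e R)^T = distance_matrix e R.
  by apply/matrixP => i j; rewrite !mxE dist_sym.
have dC := dist_sym e_sym e_conn.
have d0 := dist_self e.
apply: (second_eigenvalue_ge Dsym _ _ wy yy).
  (* The pairing of e_u with w is 1/2 + 2 - 1 - 1 = 1/2, so w is nonzero. *)
  apply: contraTneq (ltr01 : (0 : R) < 1) => w0.
  suff : form (vertex u) (vertex u + vertex v - vertex a - vertex b) = 1 / 2%:R.
    by rewrite w0 -(scale0r 0) /form bilZr mul0r; clear duv dua dub dva dvb dab; lra.
  rewrite /form !(bilDl, bilDr, bilNl, bilNr) -/form !form_vertex.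
  by rewrite duv dua dub d0 /=; clear duv dua dub dva dvb dab; lra.
(* The value at w is 4/2 + 2 d(u,v) + 2 d(a,b) - 8 = 2 + 4 + 2 - 8 = 0. *)
rewrite !(bilDl, bilDr, bilNl, bilNr) -/form !form_vertex.
rewrite !d0 (dC v u) (dC a u) (dC b u) (dC a v) (dC b v) (dC b a).
by rewrite duv dua dub dva dvb dab /=; clear duv dua dub dva dvb dab; lra.
Qed.

(** Equality would make e_z orthogonal to w, although its own value is 1/2. Positive distances keep
    diagonal terms out of the pairing. *)
Lemma diamond_unbalanced u v a b z : diamond u v a b ->
    (0 < d z u)%N -> (0 < d z v)%N -> (0 < d z a)%N -> (0 < d z b)%N ->
  (d z u + d z v)%N <> (d z a + d z b)%N.
Proof.
move=> dia zu zv za zb bal.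
have := @diamond_orthogonal u v a b (vertex z) dia.
rewrite /form !(bilDl, bilDr, bilNl, bilNr) -/form !form_vertex.
have dC := dist_sym e_sym e_conn.
rewrite dist_self !(dC _ z) (gtn_eqF zu) (gtn_eqF zv) (gtn_eqF za) (gtn_eqF zb).
rewrite /= !mul0r !addr0 -addrA -opprD -!natrD bal subrr add0r.
by move=> /(_ erefl); rewrite leNgt divr_gt0 ?ltr0n.
Qed.

(** The pairings of w with e_z, e_x and e_a are 1, 1 and 1/2, so e_z - 2 e_x + 2 e_a is orthogonal
    to w; its own value is 9/2 - 4 = 1/2. *)
Lemma diamond_pendant_path u v a b x z : diamond u v a b ->
    d x z = 1%N -> d x a = 1%N -> d x b = 2%N -> d x u = 2%N -> d x v = 2%N ->
    d z a = 2%N -> d z b = 3%N -> d z u = 3%N -> d z v = 3%N ->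
  False.
Proof.
move=> dia dxz dxa dxb dxu dxv dza dzb dzu dzv.
have := @diamond_orthogonal u v a b (vertex z - 2%:R *: vertex x + 2%:R *: vertex a) dia.
rewrite /form !(bilDl, bilDr, bilNl, bilNr, bilZl, bilZr) -/form !form_vertex.
have dC := dist_sym e_sym e_conn.
have d0 := dist_self e.
case: dia => [[duv dua dub] [dva dvb dab]].
rewrite !d0 !(dC _ z) !(dC _ x) (dC b a).
rewrite ?(dC z x) dxz dxa dxb dxu dxv dza dzb dzu dzv dua dva dab /=.
clear dxz dxa dxb dxu dxv dza dzb dzu dzv duv dua dub dva dvb dab; refine (fun H => _ (H _)).
  lra.
lra.
Qed.

Hypotheses (e_irr : irreflexive e) (e_chordal : chordal e).

Lemma dist1 s t : e s t -> d s t = 1%N.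
Proof.
move=> est; apply/eqP; rewrite eqn_leq dist_edge_le // lt0n dist_eq0 //.
by apply: contraTneq est => ->; rewrite e_irr.
Qed.

(** Separation from [v] fixes the distances to [v] in terms of those to [a] and [b], which leaves
    only balanced diamonds or the pendant path. *)
Lemma no_far_vertex u v a b x z : e a b -> e u a -> e u b -> e v a -> e v b ->
    u \notin [set a; b] -> v \notin [set a; b] ->
    ~~ connect (del_rel e [set a; b]) u v -> ~~ connect (del_rel e [set a; b]) z v ->
    e z x -> e x a -> (1 < d z a)%N -> (1 < d z b)%N ->
  False.
Proof.
set S := [set a; b] => eab eua eub eva evb uS vS nuv nzv ezx exa za zb.
have dC := dist_sym e_sym e_conn.
have tri s t w : (d s w <= d s t + d t w)%N by apply: dist_triangle.
have dab := dist1 eab; have dua := dist1 eua; have dub := dist1 eub.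
have dva := dist1 eva; have dvb := dist1 evb.
have dav : d a v = 1%N by rewrite dC.
have dbv : d b v = 1%N by rewrite dC.
have dba : d b a = 1%N by rewrite dC.
have dzx := dist1 ezx; have dxa := dist1 exa.
have notS t : (0 < d t a)%N -> (0 < d t b)%N -> t \notin S.
  by rewrite !inE !lt0n !dist_eq0 // negb_or => ->.
have zS : z \notin S by rewrite notS // ltnW.
(* Every path from [t] to [v] passes through [a] or [b], each adjacent to [v]. *)
have far_v t : t \notin S -> ~~ connect (del_rel e S) t v ->
    (d t a + 1 <= d t v)%N \/ (d t b + 1 <= d t v)%N.
  move=> tS ntv; have [s] := separated_dist e_conn tS ntv.
  by rewrite !inE => /orP[/eqP->|/eqP->]; rewrite ?dav ?dbv; [left|right].
have sep_v t : e z t -> t \notin S -> ~~ connect (del_rel e S) t v.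
  move=> ezt tS; apply: contra nzv => tv; apply: connect_trans tv.
  by rewrite connect1 // /del_rel /= zS tS.
have dza : d z a = 2%N by have := tri z x a; rewrite dzx dxa; move: za; clear; lia.
have dxb0 : (0 < d x b)%N.
  by rewrite lt0n; apply/eqP => /eqP; rewrite dist_eq0 // => /eqP xb; move: zb; rewrite -xb dzx.
have duv : d u v = 2%N.
  have [] := far_v u uS nuv; have := tri u a v; rewrite ?dua ?dub dav; clear; lia.
have xS : x \notin S by rewrite notS // dxa.
have nxv := sep_v _ ezx xS.
have dxv : d x v = 2%N.
  have [] := far_v x xS nxv; have := tri x a v; rewrite ?dxa dav; move: dxb0; clear; lia.
have dzv : d z v = 3%N.
  have [] := far_v z zS nzv; have := tri z a v; rewrite ?dza dav; move: zb; clear; lia.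
have [zb2|zb3] : d z b = 2%N \/ d z b = 3%N by have := tri z a b; rewrite dza dab; move: zb; clear; lia.
  have [x' [ezx' ex'b]] : exists x', e z x' /\ e x' b.
    have [p [ep lp sp]] := dist_path e_conn z b.
    rewrite zb2 in sp; case: p ep lp sp => [|x' [|b' [|//]]] //= /and3P[? ? _] <- _.
    by exists x'.
  (* If neither [x] nor [x'] is already such a vertex, the cycle [a], [x], [z], [x'], [b] has a
     triangle on [a b]; its apex cannot be [z], which is not adjacent to [a]. *)
  have [t [ezt eta etb]] : exists t, [/\ e z t, e t a & e t b].
    have [exb|nxb] := boolP (e x b); first by exists x.
    have [ex'a|nx'a] := boolP (e x' a); first by exists x'.
    have ep : path e a (rcons [:: x; z; x'] b).
      by rewrite /= (e_sym a) exa (e_sym x) ezx ezx' ex'b.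
    have [||t] := triangle_on_edge e_sym e_irr e_chordal eab ep.
    - have ne s t : e s t -> s != t by apply: contraTneq => ->; rewrite e_irr.
      have nza : ~~ e z a by apply: contraTN za => /dist1->.
      have nzb : ~~ e z b by apply: contraTN zb => /dist1->.
      have xx' : x != x' by apply: contraNneq nxb => ->.
      have za' : z != a by apply: contraTneq za => ->; rewrite dist_self.
      have zb' : z != b by apply: contraTneq zb => ->; rewrite dist_self.
      have x'a : x' != a by apply: contraNneq nza => <-.
      have xb : x != b by apply: contraNneq nzb => <-.
      rewrite /= !inE !negb_or !(eq_sym a) (ne _ _ exa) za' x'a (eq_sym b) (ne _ _ eab).
      by rewrite (eq_sym x z) (ne _ _ ezx) xx' xb (ne _ _ ezx') zb' (ne _ _ ex'b).
    - by [].
    rewrite !inE => /or3P[]/eqP-> /andP[eat etb]; [exists x|exfalso|exists x'] => //.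
    - by move: za; rewrite dC (dist1 eat).
    - by rewrite (e_sym x') eat.
  have dzt := dist1 ezt; have dta := dist1 eta; have dtb := dist1 etb.
  have tS : t \notin S by rewrite notS ?dta ?dtb.
  have dtv : d t v = 2%N.
    have [] := far_v t tS (sep_v _ ezt tS); have := tri t a v; rewrite ?dta ?dtb dav; clear; lia.
  (* Balanced: 1 + 3 = 2 + 2. *)
  by apply: (@diamond_unbalanced t v a b z) => //; rewrite ?dzt ?dzv ?dza ?zb2.
have dxb : d x b = 2%N by have := tri x a b; have := tri z x b; rewrite zb3 dzx dxa dab; clear; lia.
have dia : diamond u v a b by [].
have dxu : d x u = 2%N.
  have dau : d a u = 1%N by rewrite dC.
  have xu0 : (0 < d x u)%N.
    rewrite lt0n dist_eq0 //; apply/eqP => xu; move: dxb; by rewrite xu dub.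
  (* The value d(x,u) = 1 would balance: 1 + 2 = 1 + 2. *)
  have := @diamond_unbalanced u v a b x dia.
  rewrite dxv dxa dxb xu0; have := tri x a u; rewrite dxa dau; move: xu0; clear; lia.
apply: (diamond_pendant_path dia (x := x) (z := z)) => //.
  by rewrite dC.
have dau : d a u = 1%N by rewrite dC.
(* The triangle inequality leaves 2 or 3 for d(z,u), and 2 would balance: 2 + 3 = 2 + 3. *)
have := @diamond_unbalanced u v a b z dia.
rewrite dzv dza zb3; have := tri z a u; have := tri z u b.
rewrite zb3 dub dza dau; clear; lia.
Qed.
End Forbidden.

(** * The diameter bound around a separating edge *)

Theorem proposition5 (R : rcfType) (T : finType) (e : rel T)
    (e_simple : simple_graph e) (e_conn : connected_graph e)
    (e_chordal : chordal e)
    (e_sep2 : exists S : {set T}, minimal_vertex_separator e S /\ #|S| = 2%N)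
    (lambda2_lt : dist_eigenvalue R e 2 < - (1 / 2%:R)) :
  (diameter e <= 3)%N.
Proof.
have [e_sym e_irr] := e_simple.
have [S [[u0 [v0 [_ _ minS]]] cardS]] := e_sep2.
have [a [b [u [v [SE eab [uS eau eub] [vS eav evb] nuv]]]]] :=
  separator_diamond e_sym e_irr e_chordal minS cardS.
rewrite {}SE {S minS cardS} in uS vS nuv.
pose near := [pred t | (dist e t a <= 1) || (dist e t b <= 1)]%N.
have dC := dist_sym e_sym e_conn.
(* If all vertices are near, any two are joined through the edge [a b] within 1 + 1 + 1. *)
have [all_near|] := boolP [forall t, near t].
  apply/bigmax_leqP => -[s t] _ /=.
  have close r : exists2 c, c \in [set a; b] & (dist e r c <= 1)%N.
    by have /orP[] := forallP all_near r; [exists a|exists b]; rewrite ?set21 ?set22.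
  have [[c cS sc] [c' c'S tc']] := (close s, close t).
  have cc' : (dist e c c' <= 1)%N.
    by move: cS c'S; rewrite !inE => /orP[]/eqP-> /orP[]/eqP->;
      rewrite dist_le1 ?eqxx ?eab ?(e_sym b) ?eab ?orbT.
  have := dist_triangle e_conn c s t; have := dist_triangle e_conn c' c t.
  by rewrite (dC c' t); move: sc tc' cc'; clear; lia.
case/forallPn=> w farw; exfalso.
(* By connectivity some edge leads from a near vertex to a far one. *)
have [/existsP[x /existsP[z /and3P[nx fz exz]]]|none] :=
  boolP [exists x, [exists z, [&& near x, ~~ near z & e x z]]]; last first.
  case/negP: farw; apply: (connect_preserves _ _ (e_conn a w)); last by rewrite /= dist_self.
  move=> x z nx exz; apply: contraNT none => fz.
  by apply/existsP; exists x; apply/existsP; exists z; rewrite nx fz.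
move: fz; rewrite negb_or -!ltnNge => /andP[za zb].
have ezx : e z x by rewrite e_sym.
have eua : e u a by rewrite e_sym.
have eva : e v a by rewrite e_sym.
have eba : e b a by rewrite e_sym.
have nvu : ~~ connect (del_rel e [set a; b]) v u by rewrite connect_del_sym.
(* As [u] and [v] are separated, [z] cannot be connected to both. *)
have nzvu : ~~ connect (del_rel e [set a; b]) z v || ~~ connect (del_rel e [set a; b]) z u.
  rewrite -negb_and; apply: contra nuv => /andP[zv zu].
  by apply: connect_trans zv; rewrite connect_del_sym.
have exab : e x a || e x b.
  case/orP: nx; rewrite dist_le1 // => /predU1P[xE|->]; rewrite ?orbT //.
    by move: za; rewrite -xE ltnNge dist_edge_le.
  by move: zb; rewrite -xE ltnNge dist_edge_le.
have no_far := no_far_vertex e_sym e_conn lambda2_lt e_irr e_chordal.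
(* The configuration is symmetric under exchanging [u] with [v] and [a] with [b]. *)
case/orP: exab => [exa|exb]; case/orP: nzvu => nz.
- exact: (no_far u v a b x z).
- exact: (no_far v u a b x z).
- by apply: (no_far u v b a x z); rewrite // setUC.
- by apply: (no_far v u b a x z); rewrite // setUC.
Qed.
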